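(* Let $\{\xi_n\}_{n\ge0}$ be a positive martingale on the probability space $([0,1],\mathcal B,dx)$ adapted to the discrete time dyadic filtration $\mathcal F_0\subset\mathcal F_1\subset\cdots$, such that $\xi_N=\xi_{N+1}=\cdots=\xi_\infty>0$ for some sufficiently large $N$. Then $$\log\mathbb E\,\xi_\infty-\mathbb E\log\xi_\infty\le\mathbb E\log\left(1+\frac{[\xi_\infty]}{\xi_\infty^2}\right),$$ where $[\xi_\infty]=\sum_{k\ge0}(\xi_{k+1}-\xi_k)^2$ is the quadratic variation.
   Context: Dyadic filtration: for $n\ge0$, $\mathcal F_n$ is the $\sigma$-algebra on $[0,1)$ generated by the dyadic intervals $[k2^{-n},(k+1)2^{-n})$, $k=0,\dots,2^n-1$; in particular $\mathcal F_0$ is trivial. $\mathcal B$ is the Borel $\sigma$-algebra and $dx$ is Lebesgue measure. *)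

(* Defs.v *)
From HB Require Import structures.
From mathcomp Require Import all_boot all_order all_algebra.
From mathcomp Require Import all_classical all_reals all_analysis.

Set Implicit Arguments.
Unset Strict Implicit.
Unset Printing Implicit Defensive.

Import Order.TTheory GRing.Theory Num.Theory.
Import numFieldNormedType.Exports.

Local Open Scope classical_set_scope.
Local Open Scope ring_scope.

Section martingale.
Context d (T : measurableType d) (R : realType) (P : probability T R).

(* [Y] is a version of the conditional expectation E[X | G], for a
   sub-sigma-algebra [G] of the sigma-algebra of [T]. *)
Definition is_cond_expectation (G : set (set T)) (X Y : T -> R) : Prop :=
  [/\ g_sigma_algebra_preimage (Y : T -> measurableTypeR R) `<=` G,
      P.-integrable setT (EFin \o Y) &
      forall A, G A ->
        (\int[P]_(x in A) (Y x)%:E = \int[P]_(x in A) (X x)%:E)%E].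

Definition is_filtration (F : nat -> set (set T)) : Prop :=
  [/\ forall n, sigma_algebra setT (F n),
      forall n, F n `<=` measurable &
      forall n, F n `<=` F n.+1].

Definition adapted (F : nat -> set (set T)) (X : nat -> T -> R) : Prop :=
  forall n, g_sigma_algebra_preimage (X n : T -> measurableTypeR R) `<=` F n.

Definition martingale (F : nat -> set (set T)) (X : nat -> T -> R) : Prop :=
  [/\ adapted F X,
      forall n, P.-integrable setT (EFin \o X n) &
      forall n, is_cond_expectation (F n) (X n.+1) (X n)].

End martingale.

(* A real-valued infinite sum: [limn] is only meaningful when the series
   converges, as it does when [X] is eventually stationary. *)
Definition quadratic_variation (T : Type) (R : realType) (X : nat -> T -> R)
  (x : T) : R := limn (series (fun k => (X k.+1 x - X k x) ^+ 2)).

Section unit_interval.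
Variable R : realType.

(* The sample space is [0, 1), on which the dyadic sigma-algebras live: it is
   [0, 1] deprived of the null set {1}. *)
Definition unit_interval_carrier : Type := {x : R | 0 <= x < 1}.

HB.instance Definition _ :=
  Choice.copy unit_interval_carrier {x : R | 0 <= x < 1}.

Fact unit_interval_0_subproof : 0 <= (0 : R) < 1.
Proof. by rewrite lexx ltr01. Qed.

HB.instance Definition _ := isPointed.Build unit_interval_carrier
  (exist _ 0 unit_interval_0_subproof).

Definition unit_interval_val (x : unit_interval_carrier) : measurableTypeR R :=
  sval x.

(* [0, 1) with its Borel sigma-algebra, the trace of that of the real line;
   [dx] is the restriction of the Lebesgue measure. *)
Definition unit_interval := g_sigma_algebra_preimageType unit_interval_val.

Definition dx (A : set unit_interval) : \bar R :=
  lebesgue_measure (unit_interval_val @` A).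

Lemma image_unit_interval_val (B : set R) :
  unit_interval_val @` (unit_interval_val @^-1` B) = `[0, 1[ `&` B.
Proof.
apply/seteqP; split => [_ [[x /= x01] /= Bx <-]|x [x01 Bx]].
  by split => //; rewrite /= in_itv.
by move: x01; rewrite /= in_itv /= => x01; exists (exist _ x x01).
Qed.

Lemma unit_interval_val_inj : injective unit_interval_val.
Proof. exact: val_inj. Qed.

Lemma measurable_image_unit_interval (A : set unit_interval) :
  measurable A -> measurable (unit_interval_val @` A : set (measurableTypeR R)).
Proof.
move=> [B mB <-]; rewrite setTI image_unit_interval_val.
by apply: measurableI => //; exact: measurable_itv.
Qed.

Let dx0 : dx set0 = 0%E.
Proof. by rewrite /dx image_set0 measure0. Qed.

Let dx_ge0 A : (0 <= dx A)%E.
Proof. exact: measure_ge0. Qed.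

Let dx_sigma_additive : semi_sigma_additive dx.
Proof.
move=> F mF tF mUF; rewrite /dx image_bigcup.
apply: measure_semi_sigma_additive.
- by move=> n; exact: measurable_image_unit_interval.
- apply/trivIsetP => i j _ _ ij; apply/seteqP; split => // x [[y Fy <-] [z Fz]].
  move=> /unit_interval_val_inj zy; rewrite zy in Fz.
  move/trivIsetP : tF => /(_ i j Logic.I Logic.I ij) /seteqP[FF0 _].
  exact: (FF0 y).
- by rewrite -image_bigcup; exact: measurable_image_unit_interval.
Qed.

HB.instance Definition _ :=
  isMeasure.Build _ _ _ dx dx0 dx_ge0 dx_sigma_additive.

Let dx_setT : dx setT = 1%E.
Proof.
rewrite /dx -(preimage_setT unit_interval_val) image_unit_interval_val setIT.
by rewrite lebesgue_measure_itv /= lte_fin ltr01 oppr0 adde0.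
Qed.

HB.instance Definition _ := @Measure_isProbability.Build _ _ R dx dx_setT.

Definition dyadic_interval (n k : nat) : set unit_interval :=
  unit_interval_val @^-1` `[k%:R / 2 ^+ n, k.+1%:R / 2 ^+ n[.

Definition dyadic_filtration (n : nat) : set (set unit_interval) :=
  <<s [set dyadic_interval n k | k in [set k | (k < 2 ^ n)%N]] >>.

Lemma dyadic_filtrationP : is_filtration dyadic_filtration.
Proof.
split => [n|n|n].
- exact: smallest_sigma_algebra.
- apply: smallest_sub; first exact: sigma_algebra_measurable.
  move=> _ [k _ <-]; exists `[k%:R / 2 ^+ n, k.+1%:R / 2 ^+ n[%classic.
    exact: measurable_itv.
  by rewrite setTI.
- apply: smallest_sub; first exact: smallest_sigma_algebra.
  move=> _ [k /= kn <-].
  have -> : dyadic_interval n k =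
      dyadic_interval n.+1 k.*2 `|` dyadic_interval n.+1 k.*2.+1.
    have E m : (m.*2)%:R / 2 ^+ n.+1 = m%:R / 2 ^+ n :> R.
      by rewrite -muln2 natrM exprS invfM mulrA mulfK ?pnatr_eq0.
    rewrite /dyadic_interval -preimage_setU -doubleS !E.
    congr (_ @^-1` _); apply/seteqP; split => x /=; rewrite !in_itv /=.
      move=> /andP[-> ->]; rewrite andbT /=.
      by case: ltP => _; [left|right].
    have lt1 : k%:R / 2 ^+ n <= k.*2.+1%:R / 2 ^+ n.+1 :> R.
      by rewrite -E ler_pM2r ?invr_gt0 ?exprn_gt0// ler_nat.
    have lt2 : k.*2.+1%:R / 2 ^+ n.+1 <= k.+1%:R / 2 ^+ n :> R.
      by rewrite -E ler_pM2r ?invr_gt0 ?exprn_gt0// ler_nat doubleS.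
    case=> /andP[h1 h2]; apply/andP; split => //.
      exact: lt_le_trans h2 lt2.
    exact: le_trans lt1 h1.
  apply: (@measurableU _ (g_sigma_algebraType [set dyadic_interval n.+1 k | k in
      [set k | (k < 2 ^ n.+1)%N]])); apply: sub_sigma_algebra.
    by exists k.*2 => //=; rewrite expnS mul2n ltn_double.
  by exists k.*2.+1 => //=; rewrite expnS mul2n ltn_Sdouble.
Qed.

Lemma dyadic_filtration0 : dyadic_filtration 0 `<=` [set set0; setT].
Proof.
apply: smallest_sub.
  split; first by left.
  - by move=> A [->|->]; [right; rewrite setD0|left; rewrite setDv].
  - move=> F F01; have [[i Fi]|nF] := pselect (exists i, F i = setT).
      by right; apply/seteqP; split => // x _; exists i => //; rewrite Fi.
    left; apply/seteqP; split => // x [i _].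
    by case: (F01 i) => [->//|FT]; case: nF; exists i.
move=> _ [[|k] //= _ <-]; right; apply/seteqP; split => // -[x x01] _.
by rewrite /dyadic_interval /= in_itv /= expr0 mul0r divr1.
Qed.

End unit_interval.

(* Main.v *)
(** With [Q n] the quadratic variation up to time [n], the functional
    [E ln (xi n + Q n / xi n)] is nondecreasing in [n]: on each dyadic cell this
    is a two-point inequality, which after exponentiation is a polynomial
    identity with a nonnegative remainder. Its value at time [0] is
    [ln (E xi_oo)] and its value at a time when [xi] is stationary is
    [E ln xi_oo + E ln (1 + [xi_oo] / xi_oo^2)]. *)

Require Import Defs.
From HB Require Import structures.
From mathcomp Require Import all_boot all_order all_algebra.
From mathcomp Require Import all_classical all_reals all_analysis.
From mathcomp Require Import measurable_realfun ring lra.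

Set Implicit Arguments.
Unset Strict Implicit.
Unset Printing Implicit Defensive.

Import Order.TTheory GRing.Theory Num.Theory.
Import numFieldNormedType.Exports.

Local Open Scope classical_set_scope.
Local Open Scope ring_scope.

(** Here [a] stands for the martingale on a cell, [b] and [c] for its values on the two halves, [q]
    for the quadratic variation so far. Both increments have the same square since
    [b - a = -(c - a)]. *)
Lemma ln_two_point (R : realType) (a b c q : R) :
  0 < a -> 0 < b -> 0 < c -> 0 <= q -> b + c = 2 * a ->
  2 * (ln (a ^+ 2 + q) - ln a) <=
  (ln (b ^+ 2 + (q + (b - a) ^+ 2)) - ln b) +
  (ln (c ^+ 2 + (q + (c - a) ^+ 2)) - ln c).
Proof.
move=> a0 b0 c0 q0 bc.
have sq0 x y : 0 < x -> 0 <= y -> 0 < x ^+ 2 + y :> R.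
  by move=> x0 y0; rewrite ltr_wpDr// exprn_gt0.
have aq0 : 0 < a ^+ 2 + q by exact: sq0.
have bq0 : 0 < b ^+ 2 + (q + (b - a) ^+ 2).
  by apply: sq0 => //; rewrite addr_ge0// sqr_ge0.
have cq0 : 0 < c ^+ 2 + (q + (c - a) ^+ 2).
  by apply: sq0 => //; rewrite addr_ge0// sqr_ge0.
suff : ln ((a ^+ 2 + q) * (a ^+ 2 + q) * (b * c)) <=
    ln ((b ^+ 2 + (q + (b - a) ^+ 2)) * (c ^+ 2 + (q + (c - a) ^+ 2)) * (a * a)).
  rewrite !lnM ?posrE ?mulr_gt0//; lra.
rewrite ler_ln ?posrE ?mulr_gt0//.
have -> : c = 2 * a - b by rewrite -bc; ring.
rewrite -subr_ge0.
(* With [s = b - a], the factors are [a^2 + q + 2 s^2 + 2 a s] and [a^2 + q + 2 s^2 - 2 a s], so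
   only even powers of [s] survive. *)
have -> : (b ^+ 2 + (q + (b - a) ^+ 2)) *
      ((2 * a - b) ^+ 2 + (q + (2 * a - b - a) ^+ 2)) * (a * a) -
    (a ^+ 2 + q) * (a ^+ 2 + q) * (b * (2 * a - b)) =
    a ^+ 2 * (4 * (b - a) ^+ 2 * q + 4 * (b - a) ^+ 4) +
    (b - a) ^+ 2 * (a ^+ 2 + q) ^+ 2 by ring.
have e4 : (b - a) ^+ 4 = ((b - a) ^+ 2) ^+ 2 by rewrite -exprM.
have t0 := sqr_ge0 (b - a); rewrite e4; move: ((b - a) ^+ 2) t0 => t t0.
apply: addr_ge0; apply: mulr_ge0 => //; try exact: sqr_ge0.
by apply: addr_ge0; apply: mulr_ge0; rewrite ?sqr_ge0// mulr_ge0.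
Qed.

(** * Dyadic cells of the unit interval and their measure *)

Section dyadic.
Variable R : realType.
Local Notation I := (@dyadic_interval R).

Lemma dyadic_intervalP n k (x : unit_interval R) :
  I n k x <-> k%:R <= sval x * 2 ^+ n < k.+1%:R.
Proof.
rewrite /dyadic_interval /= in_itv /=.
by rewrite ler_pdivrMr ?exprn_gt0// ltr_pdivlMr ?exprn_gt0.
Qed.

Lemma dyadic_interval_neq0 n k : (k < 2 ^ n)%N -> I n k !=set0.
Proof.
move=> kn; have h : 0 <= (k%:R / 2 ^+ n : R) < 1.
  by rewrite divr_ge0//= ltr_pdivrMr ?exprn_gt0// mul1r -natrX ltr_nat.
exists (exist (fun x : R => is_true (0 <= x < 1)) _ h); apply/dyadic_intervalP => /=.
by rewrite divfK ?expf_neq0 ?pnatr_eq0// lexx ltr_nat ltnSn.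
Qed.

Lemma dyadic_interval_inj n j k x : I n j x -> I n k x -> j = k.
Proof.
move=> /dyadic_intervalP/andP[h1 h2] /dyadic_intervalP/andP[h3 h4].
have := le_lt_trans h1 h4; have := le_lt_trans h3 h2.
by rewrite !ltr_nat !ltnS => kj jk; apply/eqP; rewrite eqn_leq jk kj.
Qed.

Lemma dyadic_interval_cover n x : exists2 k, (k < 2 ^ n)%N & I n k x.
Proof.
have x0 : 0 <= sval x * 2 ^+ n by case: x => x /= /andP[x0 _]; rewrite mulr_ge0.
have xk := truncn_itv x0.
exists (Num.truncn (sval x * 2 ^+ n)); last exact/dyadic_intervalP.
have x1 : sval x * 2 ^+ n < (2 ^ n)%:R.
  by case: x {x0 xk} => x /= /andP[_ x1]; rewrite natrX gtr_pMl ?exprn_gt0.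
by rewrite -(ltr_nat R); apply: le_lt_trans x1; case/andP: xk.
Qed.

Lemma measurable_dyadic_interval n k : measurable (I n k).
Proof.
exists `[k%:R / 2 ^+ n, k.+1%:R / 2 ^+ n[%classic; last by rewrite setTI.
exact: measurable_itv.
Qed.
Local Hint Resolve measurable_dyadic_interval : core.

Lemma dx_dyadic_interval n k : (k < 2 ^ n)%N -> dx (I n k) = (2 ^- n)%:E.
Proof.
move=> kn; rewrite /dx /dyadic_interval image_unit_interval_val.
have -> : `[0%R, 1%R[ `&` `[k%:R / 2 ^+ n, k.+1%:R / 2 ^+ n[ =
    `[k%:R / 2 ^+ n, (k.+1%:R / 2 ^+ n : R)[%classic.
  apply/setIidr => x /=; rewrite !in_itv/= => /andP[h1 h2]; apply/andP; split.
    by apply: le_trans h1; rewrite divr_ge0.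
  apply: lt_le_trans h2 _.
  by rewrite ler_pdivrMr ?exprn_gt0// mul1r -natrX ler_nat.
rewrite lebesgue_measure_itv /= lte_fin ltr_pM2r ?invr_gt0 ?exprn_gt0//.
by rewrite ltr_nat ltnSn -EFinB -mulrBl -natrB// subSnn mul1r.
Qed.

Lemma dyadic_interval_split n k :
  I n k = I n.+1 k.*2 `|` I n.+1 k.*2.+1.
Proof.
(* Even endpoints at level [n.+1] are the endpoints at level [n]; the odd one is the midpoint. *)
have E m (y : R) : (m.*2%:R <= y * 2 ^+ n.+1) = (m%:R <= y * 2 ^+ n).
  by rewrite exprS mulrCA -muln2 natrM mulrC ler_pM2l.
have E' m (y : R) : (y * 2 ^+ n.+1 < m.*2%:R) = (y * 2 ^+ n < m%:R).
  by rewrite !ltNge E.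
apply/seteqP; split => x.
  move=> /dyadic_intervalP/andP[h1 h2].
  have [lt|ge] := ltP (sval x * 2 ^+ n.+1) (k.*2.+1)%:R; [left|right];
    apply/dyadic_intervalP; first by rewrite E h1.
  by rewrite -doubleS E' h2 ge.
case=> /dyadic_intervalP/andP[h1 h2]; apply/dyadic_intervalP.
  by rewrite -E h1 -E'; apply: lt_le_trans h2 _; rewrite ler_nat doubleS.
by rewrite -E' doubleS h2 andbT -E; apply: le_trans h1; rewrite ler_nat.
Qed.

Lemma trivIset_dyadic_interval n D : trivIset D (I n).
Proof. by move=> i j _ _ [x [xi xj]]; exact: dyadic_interval_inj xi xj. Qed.

(** * Functions constant on dyadic cells and their integrals *)

(** A pointwise form of measurability for the [n]-th dyadic sigma-algebra. The cells with [k >= 2^n]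
    are empty, so the condition says nothing about them. *)
Definition dyadic_step n (f : unit_interval R -> R) :=
  forall k x y, I n k x -> I n k y -> f x = f y.

Lemma dyadic_stepS n f : dyadic_step n f -> dyadic_step n.+1 f.
Proof.
move=> sf k x y xk yk; have odk := odd_double_half k.
(* The parent of cell [k] has index [k./2]; the parity of [k] tells which half it is. *)
apply: (sf k./2); rewrite dyadic_interval_split.
- by case: (odd k) odk => odk; [right|left]; rewrite -odk in xk.
- by case: (odd k) odk => odk; [right|left]; rewrite -odk in yk.
Qed.

(** The sets that do not separate points of a common cell form a sigma-algebra containing the
    generators. The level set of [f] through [x] is one of them. *)
Lemma dyadic_step_filtration n (f : unit_interval R -> R) :
  g_sigma_algebra_preimage (f : _ -> measurableTypeR R) `<=`
    @dyadic_filtration R n ->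
  dyadic_step n f.
Proof.
move=> sf k x y xk yk.
suff H : @dyadic_filtration R n `<=`
    [set A | forall k x y, I n k x -> I n k y -> A x -> A y].
  have /sf/H/(_ _ _ _ xk yk)/= : g_sigma_algebra_preimage
      (f : _ -> measurableTypeR R) (f @^-1` [set f x]).
    by exists [set f x]; [exact: measurable_set1|rewrite setTI].
  by move=> /(_ erefl).
apply: smallest_sub; first split => //.
- move=> A HA j u v uj vj [_ nAu]; split => // Av; apply: nAu.
  (* For complements the two points trade places. *)
  exact: HA vj uj Av.
- by move=> F HF j u v uj vj [i _ Fu]; exists i => //; exact: HF uj vj Fu.
- move=> _ [j _ <-] i u v ui vi uj.
  by rewrite (dyadic_interval_inj uj ui).
Qed.

Lemma dyadic_step_measurable n f :
  dyadic_step n f -> measurable_fun setT f.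
Proof.
move=> sf; have -> : [set: unit_interval R] = \bigcup_k I n k.
  apply/seteqP; split => // x _.
  by have [k _ xk] := dyadic_interval_cover n x; exists k.
apply/measurable_fun_bigcup => // k.
have [[z zk]|/asboolPn nz] := pselect (I n k !=set0).
  apply: (@eq_measurable_fun _ _ _ _ _ (cst (f z))) => // x.
  by rewrite inE => xk; exact: sf zk xk.
have -> : I n k = set0.
  by apply/eqP/negPn/negP => /set0P; exact/asboolPn.
exact: measurable_fun_set0.
Qed.

Lemma integral_dyadic_sum n (f : unit_interval R -> R) : measurable_fun setT f ->
  (\int[@dx R]_x (f x)%:E =
   \sum_(k < 2 ^ n) \int[@dx R]_(x in I n k) (f x)%:E)%E.
Proof.
move=> mf.
have TE : [set: unit_interval R] = \big[setU/set0]_(k <- index_iota 0 (2 ^ n)) I n k.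
  apply/seteqP; split => // x _; rewrite big_mkord -bigcup_mkord.
  by have [k kn xk] := dyadic_interval_cover n x; exists k.
rewrite -(big_mkord xpredT (fun k => \int[@dx R]_(x in I n k) (f x)%:E)%E).
rewrite {1}TE integral_bigsetU_EFin//.
- exact: iota_uniq.
- exact: trivIset_dyadic_interval.
- by rewrite -TE; exact/measurable_EFinP.
Qed.

Lemma integral_dyadic_step n k f z : (k < 2 ^ n)%N -> dyadic_step n f ->
  I n k z -> (\int[@dx R]_(x in I n k) (f x)%:E = (f z * 2 ^- n)%:E)%E.
Proof.
move=> kn sf zk; rewrite (eq_integral (cst (f z)%:E)).
  by rewrite integral_cst// [X in (_ * X)%E]dx_dyadic_interval.
by move=> x; rewrite inE => xk; congr EFin; exact: sf xk zk.
Qed.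

Lemma integral_dyadic_split n k f u v : (k < 2 ^ n)%N -> dyadic_step n.+1 f ->
  I n.+1 k.*2 u -> I n.+1 k.*2.+1 v ->
  (\int[@dx R]_(x in I n k) (f x)%:E = ((f u + f v) * 2 ^- n.+1)%:E)%E.
Proof.
move=> kn sf uk vk; rewrite dyadic_interval_split integral_setU//.
- rewrite (integral_dyadic_step _ sf uk) ?(integral_dyadic_step _ sf vk)
    -?EFinD ?mulrDl//.
    by rewrite expnS mul2n ltn_Sdouble.
  by rewrite expnS mul2n ltn_double.
- exact/measurable_funTS/measurable_EFinP/(dyadic_step_measurable sf).
- apply/disj_setPS => x [xl xr].
  by have := dyadic_interval_inj xl xr => /eqP; rewrite -[_ == _]negbK neq_ltn ltnSn.
Qed.

(** The integral of the absolute value is a finite sum of real numbers, one per cell. *)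
Lemma dyadic_step_integrable n f : dyadic_step n f ->
  (@dx R).-integrable setT (EFin \o f).
Proof.
move=> sf; have mf := dyadic_step_measurable sf.
apply/integrableP; split; first exact/measurable_EFinP.
have sa : dyadic_step n (fun x => `|f x|).
  by move=> k x y xk yk; rewrite (sf k x y).
rewrite (_ : (fun _ => _) = (fun x => `|f x|%:E))//.
rewrite (integral_dyadic_sum n); last exact: dyadic_step_measurable sa.
apply: lte_sum_pinfty => k _; have kn := ltn_ord k.
by have [z zk] := dyadic_interval_neq0 kn; rewrite (integral_dyadic_step kn sa zk) ltry.
Qed.

(** * Dyadic martingales and their quadratic variation *)

Section martingale.
Variable xi : nat -> unit_interval R -> R.
Hypothesis xi_martingale : martingale (@dx R) (@dyadic_filtration R) xi.

Lemma martingale_dyadic_step n : dyadic_step n (xi n).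
Proof. by case: xi_martingale => ad _ _; apply: dyadic_step_filtration; exact: ad. Qed.

Lemma martingale_expectation n : ('E_(@dx R)[xi n] = 'E_(@dx R)[xi 0%N])%E.
Proof.
elim: n => // n <-; case: xi_martingale => _ _ /(_ n)[_ _ H].
(* The conditional expectation is tested on the whole space, obtained as the complement of
   [set0]. *)
rewrite unlock; apply/esym/H; have [+ _ _] := @dyadic_filtrationP R.
by move=> /(_ n)[F0 FC _]; rewrite -(setD0 setT); exact: FC.
Qed.

(** The conditional expectation is tested on the single cell [I n k], whose halves have equal
    measure. *)
Lemma martingale_dyadic_mean n k z u v : (k < 2 ^ n)%N -> I n k z ->
  I n.+1 k.*2 u -> I n.+1 k.*2.+1 v -> xi n.+1 u + xi n.+1 v = 2 * xi n z.
Proof.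
move=> kn zk uk vk; case: xi_martingale => _ _ /(_ n)[_ _].
have Fk : @dyadic_filtration R n (I n k) by apply: sub_sigma_algebra; exists k.
move=> /(_ _ Fk).
rewrite (integral_dyadic_step kn (martingale_dyadic_step (n:=n)) zk).
rewrite (integral_dyadic_split kn (martingale_dyadic_step (n:=n.+1)) uk vk).
case.
rewrite exprS invfM mulrA.
have n0 : (2 ^- n : R) != 0 by rewrite invr_neq0// expf_neq0// pnatr_eq0.
move/(mulIf n0) => ->.
by rewrite mulrC divfK ?pnatr_eq0.
Qed.

(** The sum runs over [k < n], so it involves only [xi 0], ..., [xi n] and is constant on cells of
    level [n]. *)
Definition partial_quadratic_variation n x : R :=
  series (fun k => (xi k.+1 x - xi k x) ^+ 2) n.
Local Notation Q := partial_quadratic_variation.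

Lemma partial_quadratic_variationS n x :
  Q n.+1 x = Q n x + (xi n.+1 x - xi n x) ^+ 2.
Proof. by rewrite /Q seriesSr. Qed.

Lemma partial_quadratic_variation_ge0 n x : 0 <= Q n x.
Proof. by rewrite /Q /series /= sumr_ge0// => i _; exact: sqr_ge0. Qed.

Lemma quadratic_variation_stationary N f x :
  (forall n, (N <= n)%N -> xi n = f) -> quadratic_variation xi x = Q N x.
Proof.
move=> xiN; apply: lim_near_cst; first exact: Rhausdorff.
exists N => // n /= Nn; rewrite -(subnKC Nn) -/(Q _ x).
elim: (n - N)%N => [|m IH]; first by rewrite addn0.
rewrite addnS partial_quadratic_variationS IH.
by rewrite !xiN ?subrr ?expr0n ?addr0 ?leq_addr// -addnS leq_addr.
Qed.

Lemma dyadic_step_partial_quadratic_variation n : dyadic_step n (Q n).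
Proof.
elim: n => [|n IH] k x y xk yk; first by rewrite /Q /series /= !big_geq.
rewrite !partial_quadratic_variationS (dyadic_stepS IH xk yk).
rewrite (martingale_dyadic_step xk yk).
by rewrite (dyadic_stepS (martingale_dyadic_step (n:=n)) xk yk).
Qed.

(** * Monotonicity of the compensated logarithm *)

Hypothesis xi_gt0 : forall n x, 0 < xi n x.

(* This is [ln (xi n + Q n / xi n)], in a form without division. *)
Definition log_compensated n x : R := ln (xi n x ^+ 2 + Q n x) - ln (xi n x).
Local Notation h := log_compensated.

Lemma dyadic_step_log_compensated n : dyadic_step n (h n).
Proof.
move=> k x y xk yk; rewrite /h (martingale_dyadic_step xk yk).
by rewrite (dyadic_step_partial_quadratic_variation xk yk).
Qed.

Lemma expectation_log_compensated_nondecreasing n :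
  ('E_(@dx R)[h n] <= 'E_(@dx R)[h n.+1])%E.
Proof.
rewrite unlock !(integral_dyadic_sum n); last 2 first.
  exact: dyadic_step_measurable (dyadic_step_log_compensated (n:=n.+1)).
  exact: dyadic_step_measurable (dyadic_step_log_compensated (n:=n)).
apply: lee_sum => -[k kn] _ /=.
have [u uk] : I n.+1 k.*2 !=set0.
  by apply: dyadic_interval_neq0; rewrite expnS mul2n ltn_double.
have [v vk] : I n.+1 k.*2.+1 !=set0.
  by apply: dyadic_interval_neq0; rewrite expnS mul2n ltn_Sdouble.
have uk' : I n k u by rewrite dyadic_interval_split; left.
have vk' : I n k v by rewrite dyadic_interval_split; right.
rewrite (integral_dyadic_step kn (dyadic_step_log_compensated (n:=n)) uk').
rewrite (integral_dyadic_split kn (dyadic_step_log_compensated (n:=n.+1)) uk vk).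
(* Cancelling the common factor [2 ^- n] leaves a factor 2 on the parent's side, as in
   [ln_two_point]. *)
rewrite lee_fin exprS invfM mulrA ler_pM2r ?invr_gt0 ?exprn_gt0//.
rewrite ler_pdivlMr// mulrC /h !partial_quadratic_variationS.
(* Quantities of level [n] agree at [u] and [v], which share the parent cell; all are expressed at
   [u]. *)
rewrite (dyadic_step_partial_quadratic_variation vk' uk').
rewrite (martingale_dyadic_step vk' uk').
apply: ln_two_point => //; first exact: partial_quadratic_variation_ge0.
exact: martingale_dyadic_mean uk' uk vk.
Qed.

Lemma expectation_log_compensated_ge n : (lne 'E_(@dx R)[xi 0%N] <= 'E_(@dx R)[h n])%E.
Proof.
elim: n => [|n IH]; last exact: le_trans (expectation_log_compensated_nondecreasing n).
have [z z0] : I 0 0 !=set0 by exact: dyadic_interval_neq0.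
(* The only cell of level 0 is the whole space, so such a function has its value at [z] as
   expectation. *)
have Ez f : dyadic_step 0 f -> ('E_(@dx R)[f] = (f z)%:E)%E.
  move=> sf; rewrite unlock (integral_dyadic_sum 0);
    last exact: dyadic_step_measurable sf.
  by rewrite big_ord1 (integral_dyadic_step _ sf z0)// expr0 invr1 mulr1.
rewrite !Ez ?lne_EFin//;
  [|exact: dyadic_step_log_compensated|exact: martingale_dyadic_step].
(* At time 0 the sum [Q] is empty and [ln (xi^2) - ln xi = ln xi]: equality holds. *)
by rewrite lee_fin /h /Q /series /= big_geq// addr0 lnXn// mulr2n addrK.
Qed.

End martingale.

End dyadic.

Theorem mainTheorem6 (R : realType) (xi : nat -> unit_interval R -> R)
    (xi_oo : unit_interval R -> R)
    (xi_martingale : martingale (@dx R) (@dyadic_filtration R) xi)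
    (xi_gt0 : forall n x, 0 < xi n x)
    (xi_stationary : exists N, forall n, (N <= n)%N -> xi n = xi_oo)
    (xi_oo_gt0 : forall x, 0 < xi_oo x) :
  (lne ('E_(@dx R)[xi_oo]) - 'E_(@dx R)[fun x => ln (xi_oo x)] <=
   'E_(@dx R)[fun x => ln (1 + quadratic_variation xi x / xi_oo x ^+ 2)%R])%E.
Proof.
have [N xiN] := xi_stationary; have <- := xiN N (leqnn N).
have QE x := quadratic_variation_stationary x xiN.
have Q0 := partial_quadratic_variation_ge0 xi N.
have slog : dyadic_step N (fun x => ln (xi N x)).
  by move=> k x y xk yk; rewrite (martingale_dyadic_step xi_martingale xk yk).
have sq : dyadic_step N (fun x => ln (1 + quadratic_variation xi x / xi N x ^+ 2)).
  move=> k x y xk yk; rewrite !QE (martingale_dyadic_step xi_martingale xk yk).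
  by rewrite (dyadic_step_partial_quadratic_variation xi_martingale xk yk).
have ilog := dyadic_step_integrable slog.
(* Finiteness allows this term to be moved across the inequality in the extended reals. *)
have flog : ('E_(@dx R)[fun x => ln (xi N x)])%E \is a fin_num.
  by rewrite unlock; exact: integrable_fin_num ilog.
rewrite martingale_expectation// leeBlDr//.
apply: le_trans (expectation_log_compensated_ge xi_martingale xi_gt0 N) _.
rewrite !unlock -integralD//; last exact: dyadic_step_integrable sq.
(* What remains is an equality of integrands: [xi N ^+ 2] factors out of the logarithm in
   [log_compensated]. *)
rewrite le_eqVlt; apply/orP; left; apply/eqP/eq_integral => x _ /=.
rewrite -EFinD /log_compensated; congr EFin.
have x20 : 0 < xi N x ^+ 2 by rewrite exprn_gt0.
have -> : xi N x ^+ 2 + partial_quadratic_variation xi N x =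
    xi N x ^+ 2 * (1 + quadratic_variation xi x / xi N x ^+ 2).
  by rewrite QE mulrDr mulr1 mulrC divfK// gt_eqF.
rewrite lnM ?posrE//; last by rewrite QE ltr_wpDr// divr_ge0// ltW.
by rewrite lnXn// mulr2n; ring.
Qed.
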